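(* There is a polynomial-time algorithm which, given any instance of weighted token swapping (on an arbitrary connected graph), outputs a valid sequence of swaps transforming the starting assignment into the destination assignment whose total cost is at most $\left(2+\frac{2W}{w}\right)\cdot\mathrm{OPT}$, where $w=\min_{t\in T}\omega(t)$, $W=\max_{t\in T}\omega(t)$, and $\mathrm{OPT}$ is the minimum cost of such a sequence.
   Context: An instance of weighted token swapping consists of a connected simple undirected graph $G=(V,E)$ with $n=|V|$ vertices, a set $T$ of $n$ tokens, a weight function $\omega:T\to\mathbb{R}_{>0}$, and two bijections $v_0,v_f:T\to V$ (starting and destination vertices). At all times each vertex holds exactly one token; initially token $t$ is on $v_0(t)$. A swap along an edge $(u,u')\in E$ exchanges the tokens on $u$ and $u'$ and costs the sum of the weights of the two swapped tokens. A valid solution is a sequence of swaps after which every token $t$ is on $v_f(t)$; its cost is the sum of the costs of its swaps. $\mathrm{OPT}$ denotes the minimum cost of a valid solution. *)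

(* Defs.v *)
From HB Require Import structures.
From mathcomp Require Import all_boot all_order all_algebra all_fingroup.
From mathcomp Require Import boolp classical_sets reals.

Set Implicit Arguments.
Unset Strict Implicit.
Unset Printing Implicit Defensive.

Import Order.TTheory GRing.Theory Num.Theory.

Local Open Scope ring_scope.

(* Vertices and tokens are both numbered 0, ..., nv - 1, since an algorithm
   works on an encoded instance.  The field [nv_gt0] says that a connected
   graph is nonempty; it is what makes min and max of the weights meaningful. *)
Record instance (R : realType) := Instance {
  nv : nat;
  nv_gt0 : (0 < nv)%N;
  adj : rel 'I_nv;
  adj_sym : symmetric adj;
  adj_irr : irreflexive adj;
  adj_connected : forall u v, connect adj u v;
  wt : 'I_nv -> R;
  wt_gt0 : forall t, 0 < wt t;
  start : 'I_nv -> 'I_nv;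
  start_bij : bijective start;
  dest : 'I_nv -> 'I_nv;
  dest_bij : bijective dest }.

Section Solutions.
Variables (R : realType) (I : instance R).

Definition vertex := 'I_(nv I).
Definition token := 'I_(nv I).

Definition config := token -> vertex.

Definition swap_tokens (c : config) (e : vertex * vertex) : config :=
  fun t => tperm e.1 e.2 (c t).

Definition swap_cost (c : config) (e : vertex * vertex) : R :=
  \sum_(t : token | (c t == e.1) || (c t == e.2)) wt t.

Fixpoint cost_from (c : config) (s : seq (vertex * vertex)) : R :=
  if s is e :: s' then swap_cost c e + cost_from (swap_tokens c e) s' else 0.

Definition cost : seq (vertex * vertex) -> R := cost_from (@start R I).

Definition solution (s : seq (vertex * vertex)) : bool :=
  all (fun e => adj e.1 e.2) s &&
  [forall t : token, foldl swap_tokens (@start R I) s t == dest t].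

(* Every instance has a solution and the infimum is attained, see
   [OPT_attained] below. *)
Definition OPT : R := inf [set cost s | s in [set s | solution s]]%classic.

Definition token0 : token := Ordinal (nv_gt0 I).
Definition wmin : R := \big[Num.min/wt token0]_(t : token) wt t.
Definition wmax : R := \big[Num.max/wt token0]_(t : token) wt t.

End Solutions.

(* A structured random access machine over two sorts, the natural numbers and
   the reals, each with its own memory: finitely many (per program) arrays,
   named by numerals, a scalar variable being cell 0 of an array.  The input is
   read-only and the output is a write-only list of swaps.

   Every assignment, test and output takes one time unit.  The only arithmetic
   operations are addition and subtraction, so the bit length of every value
   produced in polynomially many steps remains polynomial: on natural numbers
   (and on reals, for rational weights) polynomial time in this model entails
   polynomial time on a Turing machine.  Reals can only be added, subtracted,
   copied and compared. *)

Inductive nexp :=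
  | NCst of nat
  | NSize                       (* number of vertices *)
  | NStart of nexp              (* starting vertex of a token *)
  | NDest of nexp               (* destination of a token *)
  | NGet of nat & nexp          (* array name, index *)
  | NAdd of nexp & nexp
  | NSub of nexp & nexp.        (* truncated *)

Inductive rexp :=
  | RCst of nat
  | RWeight of nexp             (* weight of a token *)
  | RGet of nat & nexp
  | RAdd of rexp & rexp
  | RSub of rexp & rexp.

Inductive bexp :=
  | BEdge of nexp & nexp        (* entry of the adjacency matrix *)
  | BNle of nexp & nexp
  | BRle of rexp & rexp
  | BNot of bexp
  | BAnd of bexp & bexp.

Inductive cmd :=
  | Skip
  | NSet of nat & nexp & nexp   (* array name, index, new value *)
  | RSet of nat & nexp & rexp
  | Emit of nexp & nexp
  | Seq of cmd & cmd
  | If of bexp & cmd & cmd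
  | While of bexp & cmd.

Record state (R : realType) := State {
  nmem : nat -> nat -> nat;
  rmem : nat -> nat -> R;
  output : seq (nat * nat) }.

Definition init_state (R : realType) : state R :=
  State (fun _ _ => 0%N) (fun _ _ => 0) [::].

Definition upd (T : Type) (m : nat -> nat -> T) (a i : nat) (v : T) :=
  fun b j => if (b == a) && (j == i) then v else m b j.

Section Semantics.
Variables (R : realType) (I : instance R).

(* Reading the input out of bounds yields 0 (false for edges). *)
Definition read (T : Type) (d : T) (f : 'I_(nv I) -> T) (i : nat) : T :=
  oapp f d (insub i).

Fixpoint neval (st : state R) (e : nexp) : nat :=
  match e with
  | NCst k => k
  | NSize => nv I
  | NStart e1 => read 0%N (fun t => val (start t)) (neval st e1)
  | NDest e1 => read 0%N (fun t => val (dest t)) (neval st e1)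
  | NGet a e1 => nmem st a (neval st e1)
  | NAdd e1 e2 => (neval st e1 + neval st e2)%N
  | NSub e1 e2 => (neval st e1 - neval st e2)%N
  end.

Fixpoint reval (st : state R) (e : rexp) : R :=
  match e with
  | RCst k => k%:R
  | RWeight e1 => read 0 (@wt R I) (neval st e1)
  | RGet a e1 => rmem st a (neval st e1)
  | RAdd e1 e2 => reval st e1 + reval st e2
  | RSub e1 e2 => reval st e1 - reval st e2
  end.

Fixpoint beval (st : state R) (b : bexp) : bool :=
  match b with
  | BEdge e1 e2 =>
      read false (fun u => read false (adj u) (neval st e2)) (neval st e1)
  | BNle e1 e2 => (neval st e1 <= neval st e2)%N
  | BRle e1 e2 => reval st e1 <= reval st e2
  | BNot b1 => ~~ beval st b1
  | BAnd b1 b2 => beval st b1 && beval st b2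
  end.

(* [exec p st k st']: from [st], the program [p] halts in [st'] after [k] steps.
   Expressions have a size bounded in terms of the program only, so that
   charging one unit for the evaluation of an expression is correct up to a
   constant factor. *)
Inductive exec : cmd -> state R -> nat -> state R -> Prop :=
  | ESkip st : exec Skip st 1 st
  | ENSet st a i e :
      exec (NSet a i e) st 1
        (State (upd (nmem st) a (neval st i) (neval st e))
               (rmem st) (output st))
  | ERSet st a i e :
      exec (RSet a i e) st 1
        (State (nmem st) (upd (rmem st) a (neval st i) (reval st e))
               (output st))
  | EEmit st e1 e2 :
      exec (Emit e1 e2) st 1
        (State (nmem st) (rmem st)
               (rcons (output st) (neval st e1, neval st e2)))
  | ESeq p q st k st1 l st2 :
      exec p st k st1 -> exec q st1 l st2 -> exec (Seq p q) st (k + l) st2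
  | EIf b p q st k st1 :
      exec (if beval st b then p else q) st k st1 ->
      exec (If b p q) st k.+1 st1
  | EWhileF b p st :
      ~~ beval st b -> exec (While b p) st 1 st
  | EWhileT b p st k st1 l st2 :
      beval st b -> exec p st k st1 -> exec (While b p) st1 l st2 ->
      exec (While b p) st (k + l).+1 st2.

(* On input [I], the program [p] halts after [k] steps with output [s]. *)
Definition computes (p : cmd) (k : nat) (s : seq (vertex I * vertex I)) :=
  exists2 st, exec p (init_state R) k st &
              output st = [seq (val e.1, val e.2) | e <- s].

End Semantics.

(* The size of an instance is polynomially equivalent to its number of vertices
   (adjacency matrix and 3 * nv further entries). *)
Definition runs_in_polynomial_time (R : realType) (p : cmd) :=
  exists c d : nat, forall I : instance R, exists k s,
    computes (I := I) p k s /\ (k <= c * nv I ^ d)%N.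

Section Determinism.
Variables (R : realType) (I : instance R).

Lemma exec_det p st k st1 l st2 :
  exec I p st k st1 -> exec I p st l st2 -> k = l /\ st1 = st2.
Proof.
move=> H; elim: H l st2 => {p st k st1}.
- by move=> st l st2 H; inversion H.
- by move=> st a i e l st2 H; inversion H.
- by move=> st a i e l st2 H; inversion H.
- by move=> st e1 e2 l st2 H; inversion H.
- move=> p q st k st1 l st2 _ IHp _ IHq l' st' H.
  inversion H as [| | | |? ? ? ? ? ? ? Hp Hq| | |]; subst.
  by case: (IHp _ _ Hp) => ? ?; subst; case: (IHq _ _ Hq) => ? ?; subst.
- move=> b p q st k st1 _ IH l st2 H.
  inversion H as [| | | | |? ? ? ? ? ? Hb| |]; subst.
  by case: (IH _ _ Hb) => -> ->.
- move=> b p st bF l st2 H.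
  inversion H as [| | | | | | |? ? ? ? ? ? ? bT]; subst => //.
  by rewrite bT in bF.
- move=> b p st k st1 l st2 bT _ IHp _ IHw l' st' H.
  inversion H as [| | | | | |? ? ? bF|? ? ? ? ? ? ? ? Hp Hw]; subst.
    by rewrite bT in bF.
  by case: (IHp _ _ Hp) => ? ?; subst; case: (IHw _ _ Hw) => ? ?; subst.
Qed.

Lemma computes_det p k s l s' :
  computes (I := I) p k s -> computes (I := I) p l s' -> k = l /\ s = s'.
Proof.
case=> st1 e1 o1 [st2 e2 o2]; have [-> eqst] := exec_det e1 e2; split=> //.
move: o2; rewrite -eqst o1; apply: inj_map => -[a b] [a' b'] [/val_inj-> /val_inj->] //.
Qed.

End Determinism.

Section Attained.
Variables (R : realType) (I : instance R).

Notation swaps := (seq (vertex I * vertex I)).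

Let edges (s : swaps) := all (fun e => adj e.1 e.2) s.

Let prodt (s : swaps) : {perm vertex I} :=
  (\prod_(e <- s) tperm e.1 e.2)%g.

Let foldl_swap c s : foldl (@swap_tokens R I) c s =1 prodt s \o c.
Proof.
rewrite /prodt; elim: s c => [|e s IH] c t /=; first by rewrite big_nil perm1.
by rewrite IH /= big_cons permM.
Qed.

Let tperm_swaps u v : exists2 s, edges s & prodt s = tperm u v.
Proof.
have /connectP[p] := adj_connected u v.
elim: p u => [|x p IH] u /= => [_ ->|/andP[ux xp] vE].
  by exists [::] => //; rewrite /prodt big_nil tperm1.
have [s es ps] := IH _ xp vE.
have [<-|uv] := eqVneq u v.
  by exists [::] => //; rewrite /prodt big_nil tperm1.
have [xv|xv] := eqVneq x v.
  exists [:: (u, x)]; first by rewrite /edges /= ux.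
  by rewrite /prodt big_seq1 xv.
exists ((u, x) :: rcons s (u, x)).
  by rewrite /edges /= all_rcons /= ux.
rewrite /prodt big_cons -cats1 big_cat big_seq1 /= -/(prodt s) ps.
have -> : (tperm u x * (tperm x v * tperm u x) = tperm x v ^ tperm u x)%g.
  by rewrite /conjg tpermV.
by rewrite tpermJ tpermR tpermD.
Qed.

Let perm_swaps (g : {perm vertex I}) : exists2 s, edges s & prodt s = g.
Proof.
have [ts -> _] := prod_tpermP g.
elim: ts => [|e ts [s es ps]]; first by exists [::] => //; rewrite /prodt !big_nil.
have [s' es' ps'] := tperm_swaps e.1 e.2.
exists (s' ++ s); first by rewrite /edges all_cat -/(edges s') es'.
by rewrite /prodt big_cat big_cons /= -/(prodt s) -/(prodt s') ps ps'.
Qed.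

Lemma solution_exists : exists s : swaps, solution s.
Proof.
have [f sK fK] := start_bij I.
have inj : injective (@dest R I \o f).
  by apply: inj_comp; [exact: bij_inj (dest_bij I)|exact: can_inj fK].
have [s es ps] := perm_swaps (perm inj).
exists s; rewrite /solution -/(edges s) es; apply/forallP => t.
by rewrite foldl_swap /= ps permE /= sK.
Qed.

Let wmin_gt0 : 0 < wmin I.
Proof.
rewrite /wmin; elim/big_ind: _ => //; try by move=> *; exact: wt_gt0.
by move=> x y x0 y0; rewrite lt_min x0.
Qed.

Let cost_size (s : swaps) (c : config I) : bijective c ->
  (size s)%:R * wmin I <= cost_from c s.
Proof.
elim: s c => [|e s IH] c cB /=; first by rewrite mul0r.
rewrite -natr1 mulrDl mul1r addrC lerD //; last first.
  apply: IH; apply: (bij_comp (f := tperm e.1 e.2)) => //.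
  by exists (tperm e.1 e.2); exact: tpermK.
have [d cK dK] := cB.
rewrite /swap_cost (bigD1 (d e.1)) /=; last by rewrite dK eqxx.
apply: (le_trans (y := wt (d e.1))); last first.
  by rewrite lerDl sumr_ge0 // => t _; exact/ltW/wt_gt0.
by rewrite /wmin (bigD1 (d e.1)) //= ge_min lexx.
Qed.

Lemma OPT_attained :
  exists2 s : swaps, solution s & cost s = OPT I /\
    forall s' : swaps, solution s' -> OPT I <= cost s'.
Proof.
have [s0 sol0] := solution_exists.
pose N := Num.bound (cost s0 / wmin I).
have sizeN (s : swaps) : cost s <= cost s0 -> (size s <= N)%N.
  move=> ss0; rewrite -(ler_nat R).
  have h : (size s)%:R <= cost s0 / wmin I.
    rewrite ler_pdivlMr //; apply: le_trans _ ss0.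
    by rewrite /cost; apply: cost_size; exact: start_bij.
  apply: (le_trans h); apply/ltW; apply: archi_boundP.
  exact: le_trans h.
pose b0 : N.-bseq (vertex I * vertex I) := Bseq (sizeN _ (lexx _)).
pose P (b : N.-bseq (vertex I * vertex I)) := solution b.
have Pb0 : P b0 by [].
case: (arg_minP (fun b : N.-bseq _ => cost b) Pb0) => b Pb bmin.
have minb (s' : swaps) : solution s' -> cost b <= cost s'.
  move=> sol'; have [le|lt] := leP (cost s') (cost s0).
    exact: (bmin (Bseq (sizeN _ le))).
  exact: le_trans (bmin _ Pb0) (ltW lt).
have E : cost b = OPT I.
  apply/eqP; rewrite eq_le; apply/andP; split.
    apply: lb_le_inf; first by exists (cost b), b.
    by move=> _ [s' /= sol' <-]; exact: minb.
  apply: ge_inf; last by exists b.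
  by exists (cost b) => _ [s' /= sol' <-]; exact: minb.
by exists b => //; split=> // s' sol'; rewrite -E; exact: minb.
Qed.

End Attained.

(* Main.v *)
(* The cost of a solution is at least the sum over the tokens t of wt t times
   the distance from the start of t to its destination.  To compete with this
   bound, let x be the lightest misplaced token, b the token whose destination
   is the vertex of x, and d the distance of b to that vertex.  Exchange x and b
   along a shortest path: x and b move d times each, and each of the d - 1 tokens
   in between moves forth and back.  This brings b home, disturbs no other token
   than x, and costs at most
     d (wt x + wt b) + 2 (d - 1) W <= (2 + 2 W / w) d wt b.
   Every token is paid for once, at its initial distance, except that the current
   x is moved for free, so repeating this until no token is misplaced yields the
   ratio.  Ties between weights are broken by index, so that x remains the
   selected token until it is home. *)
Require Import Defs.
From mathcomp Require Import all_boot all_order all_algebra.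
From mathcomp Require Import reals.
From mathcomp Require Import all_fingroup zify lra.

Set Implicit Arguments.
Unset Strict Implicit.
Unset Printing Implicit Defensive.

Import Order.TTheory GRing.Theory Num.Theory.
Local Open Scope ring_scope.

Definition var (a : nat) : nexp := NGet a (NCst 0).
Definition set_var (a : nat) (e : nexp) : cmd := NSet a (NCst 0) e.
Definition bn_lt (e1 e2 : nexp) : bexp := BNot (BNle e2 e1).
Definition bn_eq (e1 e2 : nexp) : bexp := BAnd (BNle e1 e2) (BNle e2 e1).

Definition for_vertices (a : nat) (body : cmd) : cmd :=
  Seq (set_var a (NCst 0))
      (While (bn_lt (var a) NSize)
             (Seq body (set_var a (NAdd (var a) (NCst 1))))).

Fixpoint writes (p : cmd) : seq nat :=
  match p with
  | NSet a _ _ => [:: a]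
  | Seq p q | If _ p q => writes p ++ writes q
  | While _ p => writes p
  | _ => [::]
  end.

Fixpoint emits (p : cmd) : bool :=
  match p with
  | Emit _ _ => true
  | Seq p q | If _ p q => emits p || emits q
  | While _ p => emits p
  | _ => false
  end.

(* Valid for programs all of whose loops make at most [n] iterations. *)
Fixpoint time_bound (n : nat) (p : cmd) : nat :=
  match p with
  | Seq p q => time_bound n p + time_bound n q
  | If _ p q => (time_bound n p + time_bound n q).+1
  | While _ p => (time_bound n p).+1 * n + 1
  | _ => 1
  end.

Lemma time_bound_poly (p : cmd) :
  exists c d, forall n, (0 < n)%N -> (time_bound n p <= c * n ^ d)%N.
Proof.
have expD n d1 d2 : (0 < n)%N -> (n ^ d1 <= n ^ (d1 + d2))%N.
  by move=> n0; rewrite leq_pexp2l // leq_addr.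
elim: p => [|a i e|a i e|e1 e2|p [c1 [d1 h1]] q [c2 [d2 h2]]
           |b p [c1 [d1 h1]] q [c2 [d2 h2]]|b p [c [d h]]] /=;
  try by exists 1%N, 0%N.
- exists (c1 + c2)%N, (d1 + d2)%N => n n0; rewrite mulnDl leq_add //.
    by apply: (leq_trans (h1 n n0)); rewrite leq_mul2l expD ?orbT.
  by apply: (leq_trans (h2 n n0)); rewrite leq_mul2l addnC expD ?orbT.
- exists (1 + c1 + c2)%N, (d1 + d2)%N => n n0.
  rewrite !mulnDl -addnA -add1n leq_add ?leq_add //.
  + by rewrite mul1n expn_gt0 n0.
  + by apply: (leq_trans (h1 n n0)); rewrite leq_mul2l expD ?orbT.
  by apply: (leq_trans (h2 n n0)); rewrite leq_mul2l addnC expD ?orbT.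
- exists (c + 2)%N, d.+1 => n n0.
  have h' := h n n0; have n1 : (1 <= n ^ d)%N by rewrite expn_gt0 n0.
  rewrite expnSr; nia.
Qed.

Section ProgramLogic.
Variables (R : realType) (I : instance R).
Implicit Types (p q : cmd) (st : state R) (Q : state R -> Prop).

Definition frame p st st' :=
  (forall a, a \notin writes p -> nmem st' a = nmem st a) /\
  (~~ emits p -> output st' = output st).

Lemma exec_frame p st k st' : exec I p st k st' -> frame p st st'.
Proof.
rewrite /frame; elim => {p st k st'} //=.
- move=> st a i e; split=> // b; rewrite inE => /negbTE ba.
  by rewrite /upd ba.
- move=> p q st k st1 l st2 _ [w1 e1] _ [w2 e2]; split.
    by move=> a; rewrite mem_cat negb_or => /andP[ap aq]; rewrite w2 // w1.
  by rewrite negb_or => /andP[ap aq]; rewrite e2 // e1.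
- move=> b p q st k st1 _ [w1 e1]; split.
    move=> a; rewrite mem_cat negb_or => /andP[ap aq]; apply: w1.
    by case: ifP.
  by rewrite negb_or => /andP[ap aq]; apply: e1; case: ifP.
- move=> b p st k st1 l st2 _ _ [w1 e1] _ [w2 e2]; split.
    by move=> a ap; rewrite w2 // w1.
  by move=> ap; rewrite e2 // e1.
Qed.

Definition wp p st Q :=
  exists k st', [/\ exec I p st k st', (k <= time_bound (nv I) p)%N & Q st'].

Lemma wp_weaken p st Q Q' :
  wp p st Q -> (forall st', frame p st st' -> Q st' -> Q' st') -> wp p st Q'.
Proof.
move=> [k [st' [e kT q]]] QQ'; exists k, st'; split=> //.
exact: QQ' (exec_frame e) q.
Qed.

Lemma wp_skip st Q : Q st -> wp Skip st Q.
Proof. by exists 1%N, st; split=> //; exact: ESkip. Qed.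

Lemma wp_nset a i e st Q :
  Q (State (upd (nmem st) a (neval I st i) (neval I st e))
           (rmem st) (output st)) ->
  wp (NSet a i e) st Q.
Proof. by move=> q; exists 1%N; eexists; split; [exact: ENSet| |exact: q]. Qed.

Lemma wp_emit e1 e2 st Q :
  Q (State (nmem st) (rmem st)
           (rcons (output st) (neval I st e1, neval I st e2))) ->
  wp (Emit e1 e2) st Q.
Proof. by move=> q; exists 1%N; eexists; split; [exact: EEmit| |exact: q]. Qed.

Lemma wp_seq p q st Q : wp p st (fun st1 => wp q st1 Q) -> wp (Seq p q) st Q.
Proof.
move=> [k [st1 [e1 kT [l [st2 [e2 lT Q2]]]]]].
exists (k + l)%N, st2; split=> //; last by rewrite leq_add.
exact: ESeq e1 e2.
Qed.

Lemma wp_if b p q st Q :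
  (beval I st b -> wp p st Q) -> (~~ beval I st b -> wp q st Q) ->
  wp (If b p q) st Q.
Proof.
move=> hp hq; have [bT|bF] := boolP (beval I st b).
  have [k [st1 [e1 kT Q1]]] := hp bT; exists k.+1, st1; split=> //.
    by apply: EIf; rewrite bT.
  by rewrite ltnS (leq_trans kT) // leq_addr.
have [k [st1 [e1 kT Q1]]] := hq bF; exists k.+1, st1; split=> //.
  by apply: EIf; rewrite (negbTE bF).
by rewrite ltnS (leq_trans kT) // leq_addl.
Qed.

Definition with_var a v st := State (upd (nmem st) a 0 v) (rmem st) (output st).

Lemma wp_for a body st (J : nat -> state R -> Prop) Q :
  a \notin writes body ->
  (forall i v st', J i st' -> J i (with_var a v st')) ->
  J 0%N st ->
  (forall i st', (i < nv I)%N -> nmem st' a 0%N = i ->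
     frame (for_vertices a body) st st' -> J i st' -> wp body st' (J i.+1)) ->
  (forall st', frame (for_vertices a body) st st' -> J (nv I) st' -> Q st') ->
  wp (for_vertices a body) st Q.
Proof.
move=> abody Jvar J0 Jbody JQ.
apply: (@wp_weaken _ _ (J (nv I))) => //.
apply: wp_seq; apply: wp_nset => /=.
set st0 := State _ _ _.
have : frame (for_vertices a body) st st0.
  split=> // b; rewrite /= inE negb_or => /andP[/negbTE ba _].
  by rewrite /upd ba.
have : J 0%N st0 by exact: Jvar.
have : nmem st0 a 0%N = 0%N by rewrite /= /upd !eqxx.
move: st0; rewrite /wp [time_bound _ _]/=.
set T := time_bound _ body; set W := While _ _.
suff loop m i st0 : (i + m = nv I)%N -> nmem st0 a 0%N = i -> J i st0 ->
    frame (for_vertices a body) st st0 ->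
    exists k st', [/\ exec I W st0 k st', (k <= (T + 1).+1 * m + 1)%N
                    & J (nv I) st'].
  by move=> st0 a0 J0' f0; apply: loop a0 J0' f0.
elim: m i st0 => [|m IH] i st0.
  rewrite addn0 => -> a0 J0' _; exists 1%N, st0; split=> //.
    by apply: EWhileF; rewrite /= a0 leqnn.
  by rewrite addn1.
move=> im a0 J0' f0.
have i_lt : (i < nv I)%N by lia.
have [k [st1 [e1 kT J1]]] := Jbody i st0 i_lt a0 f0 J0'.
have [w1 o1] := exec_frame e1.
have a1 : nmem st1 a 0%N = i by rewrite w1.
have [||||l [st2 [e2 lT J2]]] := IH i.+1 (with_var a i.+1 st1).
- by rewrite addSnnS.
- by rewrite /= /upd !eqxx.
- exact: Jvar.
- case: f0 => w0 o0; split.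
    move=> b bw; rewrite /=; move: (bw).
    rewrite /= in_cons mem_cat !negb_or => /and3P[/negbTE ba bb _].
    by rewrite /upd ba /= w1 // w0.
  by rewrite /= orbF => nb; rewrite o1 // o0 //= orbF.
exists (k + 1 + l).+1, st2; split=> //; last by nia.
apply: EWhileT e2; first by rewrite /= a0 -ltnNge.
apply: ESeq e1 _; rewrite /with_var -(addn1 i) -a1.
exact: (@ENSet R I st1 a (NCst 0) (NAdd (var a) (NCst 1))).
Qed.

Lemma readE (T : Type) (d : T) (f : 'I_(nv I) -> T) (i : 'I_(nv I)) :
  read d f i = f i.
Proof. by rewrite /read valK. Qed.

End ProgramLogic.

Section Distance.
Variables (R : realType) (I : instance R).
Implicit Types u v : vertex I.

Fixpoint within (k : nat) u v : bool :=
  if k is k'.+1 then within k' u v || [exists u', adj u u' && within k' u' v]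
  else u == v.

Lemma within_path u (p : seq (vertex I)) :
  path (@adj R I) u p -> within (size p) u (last u p).
Proof.
elim: p u => [|u' p IH] u /=; first by rewrite eqxx.
move=> /andP[uu' /IH pw]; apply/orP; right; apply/existsP.
by exists u'; rewrite uu'.
Qed.

Lemma within_lt_nv u v : exists2 k, (k < nv I)%N & within k u v.
Proof.
have /connectP[p up ->] := adj_connected u v.
case/shortenP: up => p' up' uniqp' _; exists (size p'); last exact: within_path.
by have := card_uniqP uniqp'; have := max_card (mem (u :: p')); rewrite card_ord /= => h <-.
Qed.

Lemma within_exists u v : exists k, within k u v.
Proof. by have [k _ uv] := within_lt_nv u v; exists k. Qed.

Definition dist u v := ex_minn (within_exists u v).

Lemma within_mono k l u v : (k <= l)%N -> within k u v -> within l u v.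
Proof.
move=> /subnK <-; elim: (l - k)%N => [//|m IH] kuv.
by rewrite addSn /= IH.
Qed.

Lemma dist_leE k u v : (dist u v <= k)%N = within k u v.
Proof.
rewrite /dist; case: ex_minnP => m mw mmin; apply/idP/idP; last exact: mmin.
by move=> mk; exact: within_mono mw.
Qed.

Lemma dist_lt_nv u v : (dist u v < nv I)%N.
Proof.
have [k kn kw] := within_lt_nv u v.
by apply: leq_ltn_trans kn; rewrite dist_leE.
Qed.

Lemma dist_eq0 u v : (dist u v == 0%N) = (u == v).
Proof. by rewrite -leqn0 dist_leE. Qed.

Lemma distxx u : dist u u = 0%N.
Proof. by apply/eqP; rewrite dist_eq0. Qed.

Lemma dist_adj u u' v : adj u u' -> (dist u v <= (dist u' v).+1)%N.
Proof.
move=> uu'; rewrite dist_leE /=; apply/orP; right; apply/existsP.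
by exists u'; rewrite uu' -dist_leE leqnn.
Qed.

Lemma dist_next u v : u != v -> exists2 u', adj u u' & dist u v = (dist u' v).+1.
Proof.
rewrite -dist_eq0; case E: (dist u v) => [//|k] _.
have := leqnn (dist u v); rewrite {2}E dist_leE /= -dist_leE E ltnn /=.
case/existsP=> u' /andP[uu']; rewrite -dist_leE => u'v.
exists u' => //; have := dist_adj v uu'; rewrite E ltnS => h.
by congr _.+1; apply/eqP; rewrite eqn_leq h.
Qed.

End Distance.

Section Swaps.
Variables (R : realType) (I : instance R).
Implicit Types (c : config I) (e : vertex I * vertex I).
Implicit Types s : seq (vertex I * vertex I).

Lemma cost_from_cat c s1 s2 :
  cost_from c (s1 ++ s2) =
  cost_from c s1 + cost_from (foldl (@swap_tokens R I) c s1) s2.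
Proof. by elim: s1 c => [|e s IH] c /=; rewrite ?add0r // IH addrA. Qed.

Lemma swap_tokens_inj c e : injective c -> injective (swap_tokens c e).
Proof. by move=> ci; apply: inj_comp ci; exact: perm_inj. Qed.

Lemma foldl_swap_inj c s :
  injective c -> injective (foldl (@swap_tokens R I) c s).
Proof. by elim: s c => //= e s IH c /(swap_tokens_inj (e := e)); exact: IH. Qed.

Lemma swap_costE c x y :
  injective c -> x != y -> swap_cost c (c x, c y) = wt x + wt y.
Proof.
move=> ci xy; rewrite /swap_cost (bigD1 x) ?eqxx //= (big_pred1 y) // => t.
rewrite /= !(inj_eq ci) andb_orl andbN /= andb_idr //.
by move=> /eqP ->; rewrite eq_sym.
Qed.

Lemma cost_from_ge c s : injective c -> all (fun e => adj e.1 e.2) s ->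
  \sum_t wt t * (dist (c t) (foldl (@swap_tokens R I) c s t))%:R
    <= cost_from c s.
Proof.
elim: s c => [|[u v] s IH] c ci /=.
  by move=> _; rewrite big1 // => t _; rewrite distxx mulr0.
move=> /andP[uv es]; set c' := swap_tokens c _.
apply: le_trans (lerD (lexx _) (IH c' (swap_tokens_inj ci) es)).
rewrite /swap_cost [X in _ <= X + _]big_mkcond -big_split /=; apply: ler_sum => t _.
set f := foldl _ _ _ t.
have wt0 : 0 <= wt t := ltW (wt_gt0 t).
case: ifP => [/orP tuv|/norP[tu tv]]; last first.
  by rewrite add0r /c' /swap_tokens /= tpermD // eq_sym.
rewrite -[X in X + _]mulr1 -mulrDr ler_wpM2l // addrC natr1 ler_nat.
apply: dist_adj; rewrite /c' /swap_tokens /=.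
by case: tuv => /eqP ->; rewrite (tpermL, tpermR) // adj_sym.
Qed.

Lemma wt_le_wmax (t : token I) : wt t <= wmax I.
Proof. by rewrite /wmax (bigD1 t) //= le_max lexx. Qed.

Lemma wmin_le_wt (t : token I) : wmin I <= wt t.
Proof. by rewrite /wmin (bigD1 t) //= ge_min lexx. Qed.

Lemma wmin_gt0 : 0 < wmin I.
Proof.
rewrite /wmin; elim/big_ind: _ => //; try by move=> *; exact: wt_gt0.
by move=> x y x0 y0; rewrite lt_min x0.
Qed.

Lemma wmax_gt0 : 0 < wmax I.
Proof. exact: lt_le_trans (wt_gt0 (token0 I)) (wt_le_wmax _). Qed.

End Swaps.

Section Exchange.
Variables (R : realType) (I : instance R) (P : nat -> vertex I).

Definition route (i m : nat) := [seq (P j, P j.+1) | j <- iota i m].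

(* The token on [P i] travels to [P (i + m)], then the one it finds there
   travels back, which undoes the displacement of the tokens in between. *)
Definition exchange (i m : nat) := route i m ++ rev (route i m.-1).

Lemma exchangeS i m :
  exchange i m.+2 = (P i, P i.+1) :: rcons (exchange i.+1 m.+1) (P i, P i.+1).
Proof. by rewrite /exchange /= rev_cons -rcons_cat. Qed.

Lemma exchangeP i m (c : config I) x b :
  injective c -> c x = P i -> c b = P (i + m.+1)%N ->
  {in [pred j | (i <= j <= i + m.+1)%N] &, injective P} ->
  foldl (@swap_tokens R I) c (exchange i m.+1)
    =1 tperm (P i) (P (i + m.+1)%N) \o c /\
  cost_from c (exchange i m.+1)
    <= m.+1%:R * (wt x + wt b) + m%:R * (2 * wmax I).
Proof.
elim: m i c x b => [|m IH] i c x b ci cx cb Pi.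
  rewrite addn1 in cb Pi *; split=> //=.
  rewrite -cx -cb swap_costE //; first by rewrite !(mul1r, mul0r, addr0).
  apply/eqP => xb; move: cb; rewrite -xb cx => Pii.
  suff : i = i.+1 by lia.
  by apply: Pi => //; rewrite inE; lia.
have Pneq j k : (i <= j < k)%N -> (k <= i + m.+2)%N -> P j != P k.
  move=> ijk km; apply/eqP => Pjk.
  suff : j = k by lia.
  by apply: Pi => //; rewrite inE; lia.
have P01 : P i != P i.+1 by apply: Pneq; lia.
have P0e : P i != P (i + m.+2)%N by apply: Pneq; lia.
have P1e : P i.+1 != P (i + m.+2)%N by apply: Pneq; lia.
have [d _ dK] := injF_bij ci; set y := d (P i.+1).
have cy : c y = P i.+1 by exact: dK.
have xy : x != y by apply: contraNneq P01 => xy; rewrite -cx xy cy.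
have by_ : b != y by apply: contraNneq P1e => yb; rewrite -cb yb cy.
have xb : x != b by apply: contraNneq P0e => yb; rewrite -cb -yb cx.
set e := (P i, P i.+1); set c1 := swap_tokens c e.
have c1i : injective c1 by exact: swap_tokens_inj.
have c1x : c1 x = P i.+1 by rewrite /c1 /swap_tokens /= cx tpermL.
have c1y : c1 y = P i by rewrite /c1 /swap_tokens /= cy tpermR.
have c1b : c1 b = P (i.+1 + m.+1)%N.
  by rewrite /c1 /swap_tokens /= cb tpermD // addSnnS.
have [||||f2 cost2] := IH i.+1 c1 x b => //.
  by move=> j k; rewrite !inE => hj hk; apply: Pi; rewrite inE; lia.
rewrite exchangeS -/e -cats1.
set s := exchange _ _ in f2 cost2 *; move: s f2 cost2 => s f2 cost2.
rewrite -cat_cons foldl_cat cost_from_cat.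
rewrite [foldl _ c (e :: s)]/= [cost_from c (e :: s)]/= -/c1.
set c2 := foldl _ c1 s in f2 *; rewrite /=.
have c2i : injective c2 by exact: foldl_swap_inj.
have c2y : c2 y = P i.
  by rewrite f2 /= c1y tpermD // eq_sym // addSnnS.
have c2b : c2 b = P i.+1 by rewrite f2 /= c1b tpermR.
split.
  move=> t; rewrite /swap_tokens f2 /= /c1 /swap_tokens /= addSnnS.
  have -> : tperm (P i) (P (i + m.+2)) =
      (tperm (P i.+1) (P (i + m.+2)) ^ tperm (P i) (P i.+1))%g.
    by rewrite tpermJ tpermR tpermD.
  by rewrite /conjg tpermV !permM.
have -> : swap_cost c e = wt x + wt y by rewrite /e -cx -cy swap_costE.
have -> : swap_cost c2 e = wt y + wt b.
  by rewrite /e -c2y -c2b swap_costE // eq_sym.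
have := wt_le_wmax y; move: cost2.
rewrite addr0 -(natr1 m.+1) -(natr1 m); move: m%:R => M; lra.
Qed.

End Exchange.
Lemma all_adj_exchange (R : realType) (I : instance R) (P : nat -> vertex I) m :
  (forall j, (j < m)%N -> adj (P j) (P j.+1)) ->
  all (fun e => adj e.1 e.2) (exchange P 0 m).
Proof.
move=> adjP; have adj_route k : (k <= m)%N ->
    all (fun e => adj e.1 e.2) (route P 0 k).
  move=> km; apply/allP => _ /mapP[j + ->]; rewrite mem_iota add0n => jk.
  by apply: adjP; exact: leq_trans km.
by rewrite all_cat all_rev !adj_route // leq_pred.
Qed.

Section Rounds.
Variables (R : realType) (I : instance R).
Implicit Types (c : config I) (x b t : token I).

Definition misplaced c t := c t != dest t.

Definition lex_le x t := (wt x <= wt t) && ((wt t <= wt x) ==> (x <= t)%N).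

Definition lightest c x :=
  misplaced c x && [forall t, misplaced c t ==> lex_le x t].

Lemma lightest_uniq c x t : lightest c x -> lightest c t -> x = t.
Proof.
move=> /andP[mx /forallP/(_ t) xt] /andP[mt /forallP/(_ x) tx].
move: xt tx; rewrite mx mt /lex_le /= => /andP[xt] /[swap] /andP[tx].
by rewrite xt tx !implyTb => h1 h2; apply/val_inj/eqP; rewrite eqn_leq h1 h2.
Qed.

(* The lightest misplaced token needs no budget: the moves of the other tokens
   bring it home. *)
Definition potential c : R :=
  \sum_(t | ~~ lightest c t) wt t * (dist (c t) (dest t))%:R.

Lemma potential_ge0 c : 0 <= potential c.
Proof. by apply: sumr_ge0 => t _; rewrite mulr_ge0 // ltW // wt_gt0. Qed.

Definition approx_ratio : R := 2 + 2 * wmax I / wmin I.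

Lemma approx_ratio_ge0 : 0 <= approx_ratio.
Proof. by rewrite addr_ge0 // divr_ge0 ?mulr_ge0 // ltW // (wmax_gt0, wmin_gt0). Qed.

Lemma potential_start_le_OPT : approx_ratio * potential (@start R I) <= approx_ratio * OPT I.
Proof.
apply: (ler_wpM2l approx_ratio_ge0).
have [s /andP[es /forallP fs] [<- _]] := OPT_attained I.
apply: le_trans (cost_from_ge (bij_inj (start_bij I)) es).
rewrite /potential big_mkcond; apply: ler_sum => t _.
by case: ifP => _; [rewrite (eqP (fs t))|rewrite mulr_ge0 // ltW // wt_gt0].
Qed.

Section Round.
Variables (c : config I) (x b : token I) (P : nat -> vertex I).
Let d := dist (c b) (c x).
Hypotheses (c_inj : injective c) (x_lightest : lightest c x).
Hypotheses (dest_b : dest b = c x) (P0 : P 0%N = c b).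
Hypothesis P_dist : forall j, (j <= d)%N -> dist (P j) (c x) = (d - j)%N.

Let mis_x : misplaced c x. Proof. by case/andP: x_lightest. Qed.

Let xb : x != b.
Proof. by apply: contraNneq mis_x => xb; rewrite xb dest_b xb. Qed.

Let mis_b : misplaced c b.
Proof. by rewrite /misplaced dest_b (inj_eq c_inj) eq_sym. Qed.

Let d_gt0 : (0 < d)%N.
Proof. by rewrite lt0n dist_eq0 -dest_b. Qed.

Let wt_xb : wt x <= wt b.
Proof. by case/andP: x_lightest => _ /forallP/(_ b); rewrite mis_b => /andP[]. Qed.

Let Pd : P d = c x.
Proof. by apply/eqP; rewrite -dist_eq0 P_dist // subnn. Qed.

Let c' := foldl (@swap_tokens R I) c (exchange P 0 d).

Let exch : c' =1 tperm (c b) (c x) \o c /\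
  cost_from c (exchange P 0 d)
    <= d%:R * (wt b + wt x) + d.-1%:R * (2 * wmax I).
Proof.
rewrite -P0 -Pd /c'; case: d d_gt0 P_dist Pd => // d' _ Pdist' Pd'.
apply: exchangeP => // j k; rewrite !inE add0n /= => hj hk Pjk.
by have := Pdist' j hj; rewrite Pjk Pdist' //; lia.
Qed.

Lemma foldl_exchange : foldl (@swap_tokens R I) c (exchange P 0 d)
  =1 tperm (c b) (c x) \o c.
Proof. by case: exch. Qed.

Let c'b : c' b = dest b.
Proof. by rewrite /c' foldl_exchange /= tpermL dest_b. Qed.

Let c't t : t != x -> t != b -> c' t = c t.
Proof.
move=> tx tb; rewrite /c' foldl_exchange /= tpermD // inj_eq //; by rewrite eq_sym.
Qed.

Let mis_sub t : misplaced c' t -> misplaced c t && (t != b).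
Proof.
have [->|tb] := eqVneq t b; first by rewrite /misplaced c'b eqxx.
have [->|tx] := eqVneq t x; first by rewrite mis_x.
by rewrite /misplaced c't // => ->.
Qed.

Lemma card_misplaced_exchange :
  (#|[pred t | misplaced c' t]| < #|[pred t | misplaced c t]|)%N.
Proof.
apply: proper_card; apply/properP; split.
  by apply/subsetP => t; rewrite !inE => /mis_sub/andP[].
by exists b; rewrite !inE // /misplaced c'b eqxx.
Qed.

Lemma exchange_amortized :
  cost_from c (exchange P 0 d) + approx_ratio * potential c' <= approx_ratio * potential c.
Proof.
have [_ cost_exch] := exch.
have lx : lightest c b = false.
  by apply/negP => /(lightest_uniq x_lightest)/eqP; rewrite (negbTE xb).
rewrite {2}/potential (bigD1 b) ?lx //= mulrDr; apply: lerD.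
  apply: (le_trans cost_exch); rewrite dest_b -/d /approx_ratio.
  have [[w0 W0] wb] := (wmin_gt0 I, wmax_gt0 I, wmin_le_wt b).
  have : 2 * wmax I <= 2 * wmax I / wmin I * wt b.
    rewrite -mulrA ler_peMr //; first by rewrite mulr_ge0 // ltW.
    by rewrite mulrC ler_pdivlMr // mul1r.
  move: (2 * wmax I / wmin I) => K Kb.
  have : d.-1%:R <= d%:R :> R by rewrite ler_nat leq_pred.
  have : 0 <= d%:R :> R by [].
  move: (d%:R) (d.-1%:R) wt_xb => D D' xb' D0 D'D.
  nra.
apply: (ler_wpM2l approx_ratio_ge0).
rewrite /potential big_mkcond [leRHS]big_mkcond /=; apply: ler_sum => t _.
have wd0 : 0 <= wt t * (dist (c t) (dest t))%:R.
  by rewrite mulr_ge0 // ltW // wt_gt0.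
have home : ~~ misplaced c' t -> wt t * (dist (c' t) (dest t))%:R = 0.
  by move/negPn/eqP ->; rewrite distxx mulr0.
have [mt'|/home->] := boolP (misplaced c' t); last by rewrite if_same; case: ifP.
have /andP[mt tb] := mis_sub mt'; rewrite tb andbT.
have [lt|lt] := boolP (lightest c t); last first.
  have tx : t != x by apply: contraNneq lt => ->.
  by rewrite (c't tx tb); case: ifP.
suff -> : lightest c' t by [].
rewrite /lightest mt' /=; apply/forallP => u; apply/implyP => /mis_sub/andP[mu _].
by case/andP: lt => _ /forallP/(_ u); rewrite mu.
Qed.

End Round.
End Rounds.

Local Notation a_pos := 0%N (only parsing).
Local Notation a_light := 1%N (only parsing).
Local Notation a_partner := 2%N (only parsing).
Local Notation a_dist := 3%N (only parsing).
Local Notation a_path := 4%N (only parsing).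
Local Notation a_tmp := 5%N (only parsing).
Local Notation a_i := 6%N (only parsing).
Local Notation a_j := 7%N (only parsing).
Local Notation a_k := 8%N (only parsing).
Local Notation a_round := 9%N (only parsing).

Definition light_pos := NGet a_pos (var a_light).
Definition partner_pos := NGet a_pos (var a_partner).

Definition find_lightest : cmd :=
  Seq (set_var a_light NSize)
      (for_vertices a_i
         (If (BAnd (BNot (bn_eq (NGet a_pos (var a_i)) (NDest (var a_i))))
                   (BNot (BAnd (bn_lt (var a_light) NSize)
                               (BRle (RWeight (var a_light))
                                     (RWeight (var a_i))))))
             (set_var a_light (var a_i))
             Skip)).

Definition find_partner : cmd :=
  for_vertices a_i
    (If (bn_eq (NDest (var a_i)) light_pos) (set_var a_partner (var a_i)) Skip).

Definition relax_row : cmd :=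
  for_vertices a_k
    (If (BAnd (BEdge (var a_j) (var a_k))
              (bn_lt (NAdd (NGet a_dist (var a_k)) (NCst 1))
                     (NGet a_dist (var a_j))))
        (NSet a_dist (var a_j) (NAdd (NGet a_dist (var a_k)) (NCst 1)))
        Skip).

Definition relax_all : cmd := for_vertices a_j relax_row.

Definition compute_dist : cmd :=
  Seq (for_vertices a_i (NSet a_dist (var a_i) NSize))
      (Seq (NSet a_dist light_pos (NCst 0)) (for_vertices a_i relax_all)).

Definition next_vertex : cmd :=
  for_vertices a_j
    (If (BAnd (BEdge (NGet a_path (var a_i)) (var a_j))
              (bn_eq (NAdd (NGet a_dist (var a_j)) (NCst 1))
                     (NGet a_dist (NGet a_path (var a_i)))))
        (NSet a_path (NAdd (var a_i) (NCst 1)) (var a_j))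
        Skip).

Definition trace_path : cmd :=
  Seq (NSet a_path (NCst 0) partner_pos) (for_vertices a_i next_vertex).

Definition path_length := NGet a_dist partner_pos.

Definition emit_forth : cmd :=
  for_vertices a_i
    (If (bn_lt (var a_i) path_length)
        (Emit (NGet a_path (var a_i))
              (NGet a_path (NAdd (var a_i) (NCst 1))))
        Skip).

Definition emit_back : cmd :=
  for_vertices a_i
    (If (bn_lt (NAdd (var a_i) (NCst 1)) path_length)
        (Emit (NGet a_path (NSub path_length (NAdd (var a_i) (NCst 2))))
              (NGet a_path (NSub path_length (NAdd (var a_i) (NCst 1)))))
        Skip).

Definition exchange_positions : cmd :=
  Seq (set_var a_tmp light_pos)
      (Seq (NSet a_pos (var a_light) partner_pos)
           (NSet a_pos (var a_partner) (var a_tmp))).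

Definition round : cmd :=
  Seq find_lightest
      (If (bn_lt (var a_light) NSize)
          (Seq find_partner
          (Seq compute_dist
          (Seq trace_path
          (Seq emit_forth
          (Seq emit_back exchange_positions)))))
          Skip).

Definition token_swapping : cmd :=
  Seq (for_vertices a_i (NSet a_pos (var a_i) (NStart (var a_i))))
      (for_vertices a_round round).

Section Correctness.
Variables (R : realType) (I : instance R).
Implicit Types (st : state R) (c : config I).

Definition stores st c := forall t : token I, nmem st a_pos t = c t.

Lemma wp_find_lightest st c : stores st c ->
  wp I find_lightest st (fun st' =>
    (exists2 x, nmem st' a_light 0%N = val x & lightest c x) \/
    (nmem st' a_light 0%N = nv I /\ forall t, ~~ misplaced c t)).
Proof.
move=> stc; apply: wp_seq; apply: wp_nset => /=.
apply: (wp_for (J := fun i st' =>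
  (exists x : token I, [/\ nmem st' a_light 0%N = val x, misplaced c x
     & forall t : token I, (t < i)%N -> misplaced c t -> lex_le x t]
     /\ (x < i)%N) \/
  (nmem st' a_light 0%N = nv I /\
     forall t : token I, (t < i)%N -> ~~ misplaced c t))) => //.
- by right; split.
- move=> i st' iN + [fr _].
  have -> : i = Ordinal iN by []. move: (Ordinal iN) => t ti Jt.
  have post : nmem st' a_pos t = c t by rewrite fr //; exact: stc.
  have ltS (u : token I) : (u < t.+1)%N -> u = t \/ (u < t)%N.
    by rewrite ltnS leq_eqVlt => /predU1P[/val_inj|]; [left|right].
  apply: wp_if; rewrite /= ti post -?eqn_leq -?ltnNge !readE.
    move=> /andP[mt best]; apply: wp_nset; left; exists t => /=; split=> //.
    rewrite ti; split=> // u /ltS[-> _|ut mu]; first by rewrite /lex_le lexx leqnn.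
    case: Jt => [[x [[xE mx xmin] _]]|[_ /(_ u ut)]]; last by rewrite mu.
    move: best; rewrite xE readE ltn_ord /= -ltNge => tx.
    have /andP[xu _] := xmin u ut mu.
    by rewrite /lex_le (ltW (lt_le_trans tx xu)) leNgt (lt_le_trans tx xu).
  rewrite negb_and negbK => worse; apply: wp_skip.
  case: Jt => [[x [[xE mx xmin] xt]]|[xE none]].
    left; exists x; split; last exact: ltnW.
    split=> // u /ltS[-> mt|]; last exact: xmin.
    move: worse; rewrite xE readE ltn_ord /= negbK -[_ == _]negbK.
    by rewrite (mt : ~~ _) /= /lex_le => ->; rewrite (ltnW xt) implybT.
  right; split=> // u /ltS[->|]; last exact: none.
  by move: worse; rewrite xE ltnn /= orbF /misplaced => /eqP/val_inj ->; rewrite eqxx.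
- move=> st' _ [[x [[xE mx xmin] _]]|[xE none]]; [left|right].
    exists x => //; rewrite /lightest mx; apply/forallP => t; apply/implyP.
    exact: xmin.
  by split=> // t; exact: none.
Qed.

Lemma wp_find_partner st c (x b : token I) : stores st c ->
  nmem st a_light 0%N = x -> dest b = c x ->
  wp I find_partner st (fun st' => nmem st' a_partner 0%N = b).
Proof.
move=> stc xE bx.
apply: (wp_for (J := fun i st' => (b < i)%N -> nmem st' a_partner 0%N = b)) => //.
- move=> i st' iN + [fr _].
  have -> : i = Ordinal iN by []. move: (Ordinal iN) => t ti Jt.
  apply: wp_if; rewrite /= ti !fr // xE stc -eqn_leq readE.
    move=> /eqP/val_inj; rewrite -bx => /(bij_inj (dest_bij I)) tb.
    by apply: wp_nset => /= _; rewrite ti tb.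
  move=> tb; apply: wp_skip; rewrite ltnS leq_eqVlt => /predU1P[/val_inj bt|//].
  by move: tb; rewrite -bt bx eqxx.
- by move=> st' _; apply; exact: ltn_ord.
Qed.

Lemma wp_relax_row st (u p : vertex I) :
  nmem st a_j 0%N = u ->
  (forall w : vertex I, (dist w p <= nmem st a_dist w)%N) ->
  wp I relax_row st (fun st' =>
    [/\ forall w : vertex I, (dist w p <= nmem st' a_dist w <= nmem st a_dist w)%N
      & forall v : vertex I, adj u v ->
          (nmem st' a_dist u <= (nmem st a_dist v).+1)%N]).
Proof.
move=> uE lb.
apply: (wp_for (J := fun j st' =>
  [/\ forall w : vertex I, (dist w p <= nmem st' a_dist w <= nmem st a_dist w)%N,
      forall w : vertex I, w != u -> nmem st' a_dist w = nmem st a_dist w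
    & forall v : vertex I, (v < j)%N -> adj u v ->
          (nmem st' a_dist u <= (nmem st a_dist v).+1)%N])) => //.
- by split=> // w; rewrite lb leqnn.
- move=> i st' iN + [fr _].
  have -> : i = Ordinal iN by []. move: (Ordinal iN) => v vE [bnd same done].
  have uE' : nmem st' a_j 0%N = u by rewrite fr.
  have vS (w : vertex I) : (w < v.+1)%N -> w = v \/ (w < v)%N.
    by rewrite ltnS leq_eqVlt => /predU1P[/val_inj|]; [left|right].
  have vu : adj u v -> v != u by apply: contraTneq => ->; rewrite adj_irr.
  apply: wp_if; rewrite /= uE' vE !readE -ltnNge addn1.
    move=> /andP[uv lt_vu]; apply: wp_nset; rewrite /= uE' vE addn1.
    rewrite same ?vu // in lt_vu *.
    have upd_u : upd (nmem st') a_dist u (nmem st a_dist v).+1 a_dist u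
               = (nmem st a_dist v).+1 by rewrite /upd /= eqxx.
    have upd_w (w : vertex I) : w != u ->
        upd (nmem st') a_dist u (nmem st a_dist v).+1 a_dist w = nmem st a_dist w.
      by move=> wu; rewrite /upd /= (negbTE (wu : val w != val u)) same.
    split=> [w|w /upd_w //|w wv uw]; last first.
      rewrite upd_u; case/vS: wv => [-> //|wv].
      by apply: leq_trans (ltnW lt_vu) _; exact: done.
    have [->|wu] := eqVneq w u; last by rewrite upd_w // lb leqnn.
    rewrite upd_u (leq_trans (dist_adj p uv)) ?ltnS ?lb //=.
    by apply: leq_trans (ltnW lt_vu) _; case/andP: (bnd u).
  move=> h; apply: wp_skip; split=> // w /vS[-> uv|]; last exact: done.
  by move: h; rewrite uv /= -leqNgt (same v) ?vu //.
- by move=> st' _ [bnd _ done]; split=> // v; apply: done.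
Qed.

Lemma wp_relax_all st (p : vertex I) :
  (forall w : vertex I, (dist w p <= nmem st a_dist w)%N) ->
  wp I relax_all st (fun st' =>
    [/\ forall w : vertex I, (dist w p <= nmem st' a_dist w <= nmem st a_dist w)%N
      & forall u v : vertex I, adj u v ->
          (nmem st' a_dist u <= (nmem st a_dist v).+1)%N]).
Proof.
move=> lb.
apply: (wp_for (J := fun i st' =>
  [/\ forall w : vertex I, (dist w p <= nmem st' a_dist w <= nmem st a_dist w)%N
    & forall u v : vertex I, (u < i)%N -> adj u v ->
          (nmem st' a_dist u <= (nmem st a_dist v).+1)%N])) => //.
- by split=> // w; rewrite lb leqnn.
- move=> i st' iN + _.
  have -> : i = Ordinal iN by []. move: (Ordinal iN) => u uE [bnd done].
  apply: wp_weaken (wp_relax_row uE (p := p) _) _.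
    by move=> w; case/andP: (bnd w).
  move=> st2 _ [bnd2 done2]; split.
    move=> w; have /andP[-> h] := bnd2 w; have /andP[_] := bnd w.
    exact: leq_trans.
  move=> w v; rewrite ltnS leq_eqVlt => /predU1P[/val_inj ->|wu] adjv.
    by apply: leq_trans (done2 _ adjv) _; rewrite ltnS; case/andP: (bnd v).
  by case/andP: (bnd2 w) => _ h; apply: leq_trans h (done _ _ wu adjv).
- by move=> st' _ [bnd done]; split=> // u v; apply: done.
Qed.

Lemma wp_compute_dist st c x : stores st c -> nmem st a_light 0%N = val x ->
  wp I compute_dist st (fun st' =>
    forall u : vertex I, nmem st' a_dist u = dist u (c x)).
Proof.
move=> stc xE; apply: wp_seq.
apply: (wp_for (J := fun i st' =>
  forall u : vertex I, (u < i)%N -> nmem st' a_dist u = nv I)) => //.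
  move=> i st' _ iE _ Ji; apply: wp_nset => /= u; rewrite iE ltnS leq_eqVlt.
  by rewrite /upd /=; case: eqVneq => //= _ ui; exact: Ji.
move=> st1 [fr1 _] init1; apply: wp_seq; apply: wp_nset => /=.
rewrite !fr1 // xE stc.
apply: (wp_for (J := fun k st' =>
  [/\ forall w : vertex I, (dist w (c x) <= nmem st' a_dist w)%N
    & forall w : vertex I, (dist w (c x) <= k)%N ->
        (nmem st' a_dist w <= dist w (c x))%N])) => //.
- rewrite /= /upd /=; split=> w.
    case: eqVneq => [/val_inj ->|_]; first by rewrite distxx.
    by rewrite init1 // ltnW // dist_lt_nv.
  by rewrite leqn0 dist_eq0 => /eqP ->; rewrite eqxx.
- move=> k st' _ _ _ [lb exact_k].
  apply: wp_weaken (wp_relax_all lb) _ => st2 _ [bnd relaxed]; split.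
    by move=> w; case/andP: (bnd w).
  move=> w wk; have [wp|wp] := eqVneq w (c x).
    case/andP: (bnd w) => _ h; apply: leq_trans h _; apply: exact_k.
    by rewrite wp distxx.
  have [v wv distE] := dist_next wp.
  apply: leq_trans (relaxed _ _ wv) _; rewrite distE ltnS; apply: exact_k.
  by rewrite -ltnS -distE.
- move=> st' _ [lb exact_n] u; apply/eqP; rewrite eqn_leq lb andbT.
  by apply: exact_n; rewrite ltnW // dist_lt_nv.
Qed.

Lemma wp_next_vertex st (p : vertex I) i :
  (forall u : vertex I, nmem st a_dist u = dist u p) ->
  nmem st a_i 0%N = i ->
  wp I next_vertex st (fun st' =>
    (forall k, k != i.+1 -> nmem st' a_path k = nmem st a_path k) /\
    (forall u : vertex I, u != p -> nmem st a_path i = u ->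
       exists v : vertex I, [/\ nmem st' a_path i.+1 = v, adj u v
                              & dist u p = (dist v p).+1])).
Proof.
move=> distE iE.
apply: (wp_for (J := fun j st' =>
    (forall k, k != i.+1 -> nmem st' a_path k = nmem st a_path k) /\
    (forall u v : vertex I, (v < j)%N -> adj u v -> dist u p = (dist v p).+1 ->
       nmem st a_path i = u ->
       exists v : vertex I, [/\ nmem st' a_path i.+1 = v, adj u v
                              & dist u p = (dist v p).+1]))) => //.
- move=> j st' jN + [fr _].
  have -> : j = Ordinal jN by []. move: (Ordinal jN) => v vE [same found].
  have ii1 : i != i.+1 by rewrite neq_ltn ltnSn.
  have iE' : nmem st' a_i 0%N = i by rewrite fr.
  have distE' (w : vertex I) : nmem st' a_dist w = dist w p by rewrite fr.
  apply: wp_if; rewrite /= iE' vE same // distE' -eqn_leq.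
    move=> /andP[edge dist_uv]; apply: wp_nset; rewrite /= iE' vE addn1; split.
      by move=> k ki; rewrite /upd /= (negbTE ki) same.
    move=> u w _ _ _ iu; exists v; split; first by rewrite /upd /= eqxx.
      by move: edge; rewrite iu !readE.
    by move: dist_uv; rewrite iu distE' addn1 => /eqP.
  move=> h; apply: wp_skip; split=> // u w; rewrite ltnS leq_eqVlt.
  move=> /predU1P[/val_inj ->|wv] uw uwd iu; last exact: found uwd iu.
  by move: h; rewrite iu !readE uw distE' uwd addn1 eqxx.
- move=> st' _ [same found]; split=> // u up iu.
  by have [v uv uvd] := dist_next up; apply: found uvd iu.
Qed.

Lemma wp_trace_path st c (b : token I) (p : vertex I) :
  stores st c -> nmem st a_partner 0%N = b ->
  (forall u : vertex I, nmem st a_dist u = dist u p) ->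
  let d := dist (c b) p in
  wp I trace_path st (fun st' => exists P : nat -> vertex I,
    [/\ P 0%N = c b,
        forall j, (j <= d)%N ->
          nmem st' a_path j = P j /\ dist (P j) p = (d - j)%N
      & forall j, (j < d)%N -> adj (P j) (P j.+1)]).
Proof.
move=> stc bE distE d; apply: wp_seq; apply: wp_nset => /=; rewrite bE stc.
apply: (wp_for (J := fun i st' => exists P : nat -> vertex I,
    [/\ P 0%N = c b,
        forall j, (j <= i)%N -> (j <= d)%N ->
          nmem st' a_path j = P j /\ dist (P j) p = (d - j)%N
      & forall j, (j < i)%N -> (j < d)%N -> adj (P j) (P j.+1)])) => //.
- exists (fun=> c b); split=> // j; rewrite leqn0 => /eqP -> _.
  by rewrite subn0.
- move=> i st' _ iE [fr _] [P [P0 Pd Padj]].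
  have distE' (u : vertex I) : nmem st' a_dist u = dist u p.
    by rewrite fr //; exact: distE.
  apply: wp_weaken (wp_next_vertex distE' iE) _ => st2 _ [same next].
  have [id|di] := ltnP i d; last first.
    exists P; split=> // j ji jd; last by apply: Padj => //; lia.
    by rewrite same; [apply: Pd => //; lia|apply/eqP; lia].
  have [Pi Pid] := Pd i (leqnn i) (ltnW id).
  have Pip : P i != p by rewrite -dist_eq0 Pid subn_eq0 -ltnNge.
  have [v [vE iv distv]] := next _ Pip Pi.
  exists (fun j => if j == i.+1 then v else P j); split=> // [j ji jd|j ji jd].
    have [->|ji1] := eqVneq j i.+1; first by split=> //; lia.
    by rewrite same //; apply: Pd => //; lia.
  rewrite eqSS ltn_eqF //; case: eqVneq => [->//|ij]; apply: Padj => //.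
  by lia.
- move=> st' _ [P [P0 Pd Padj]]; exists P; split=> // j jd.
    by apply: Pd => //; apply: leq_trans jd (ltnW (dist_lt_nv _ _)).
  by apply: Padj => //; apply: leq_trans jd (ltnW (dist_lt_nv _ _)).
Qed.

Definition encode (s : seq (vertex I * vertex I)) : seq (nat * nat) :=
  [seq (val e.1, val e.2) | e <- s].

Lemma wp_emit_forth st (P : nat -> vertex I) d :
  neval I st path_length = d -> (d <= nv I)%N ->
  (forall j, (j <= d)%N -> nmem st a_path j = P j) ->
  wp I emit_forth st (fun st' =>
    output st' = output st ++ encode (route P 0 d)).
Proof.
move=> dE dn PE.
apply: (wp_for (J := fun i st' =>
  output st' = output st ++ encode (route P 0 (minn i d)))) => //.
- by rewrite min0n cats0.
- move=> i st' _ iE [fr _] out.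
  have dE' : nmem st' a_dist (nmem st' a_pos (nmem st' a_partner 0%N)) = d.
    by rewrite !fr.
  apply: wp_if; rewrite /= iE dE' -ltnNge => id; last first.
    by apply: wp_skip; rewrite out; congr (_ ++ encode (route _ _ _)); lia.
  apply: wp_emit; rewrite /= iE addn1 !fr // !PE ?(ltnW id) // out.
  rewrite (minn_idPl (ltnW id)) (minn_idPl id) rcons_cat; congr (_ ++ _).
  have -> : route P 0 i.+1 = rcons (route P 0 i) (P i, P i.+1).
    by rewrite /route -(addn1 i) iotaD map_cat cats1 add0n addn1.
  by rewrite /encode map_rcons.
- by move=> st' _ ->; rewrite (minn_idPr dn).
Qed.

Lemma wp_emit_back st (P : nat -> vertex I) d :
  neval I st path_length = d -> (d <= nv I)%N ->
  (forall j, (j <= d)%N -> nmem st a_path j = P j) ->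
  wp I emit_back st (fun st' =>
    output st' = output st ++ encode (rev (route P 0 d.-1))).
Proof.
move=> dE dn PE.
have size_route : size (rev (route P 0 d.-1)) = d.-1.
  by rewrite size_rev size_map size_iota.
apply: (wp_for (J := fun i st' => output st' =
  output st ++ encode (take i (rev (route P 0 d.-1))))) => //.
- by rewrite take0 cats0.
- move=> i st' _ iE [fr _] out.
  have dE' : nmem st' a_dist (nmem st' a_pos (nmem st' a_partner 0%N)) = d.
    by rewrite !fr.
  apply: wp_if; rewrite /= iE dE' -ltnNge addn1 => id; last first.
    by apply: wp_skip; rewrite out !take_oversize // size_route; lia.
  apply: wp_emit; rewrite /= iE dE' addn1 addn2 !fr // !PE; try lia.
  rewrite out rcons_cat; congr (_ ++ _).
  rewrite (take_nth (P 0%N, P 0%N)) ?size_route; last by lia.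
  rewrite /encode map_rcons; congr rcons; rewrite nth_rev; last first.
    by rewrite size_map size_iota; lia.
  rewrite size_map size_iota (nth_map 0%N) ?size_iota; last by lia.
  rewrite nth_iota; last by lia.
  by rewrite /= add0n; congr (val (P _), val (P _)); lia.
- by move=> st' _ ->; rewrite take_oversize // size_route; lia.
Qed.

Lemma wp_exchange_positions st c x b : injective c -> stores st c ->
  nmem st a_light 0%N = val x -> nmem st a_partner 0%N = val b -> x != b ->
  wp I exchange_positions st (fun st' =>
    stores st' (tperm (c b) (c x) \o c)).
Proof.
move=> ci stc xE bE xb.
apply: wp_seq; apply: wp_nset; apply: wp_seq; apply: wp_nset; apply: wp_nset.
move=> t /=; rewrite /upd /= xE bE !stc.
have [->|tb] := eqVneq t b; first by rewrite tpermL !eqxx.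
rewrite (negbTE (tb : val t != val b)).
have [->|tx] := eqVneq t x; first by rewrite tpermR eqxx.
by rewrite (negbTE (tx : val t != val x)) tpermD // inj_eq // eq_sym.
Qed.

Definition progress n st :=
  exists s : seq (vertex I * vertex I),
    let c := foldl (@swap_tokens R I) (@start R I) s in
    [/\ all (fun e => adj e.1 e.2) s, output st = encode s, stores st c,
        (#|[pred t | misplaced c t]| <= n)%N
      & cost s + approx_ratio I * potential c <= approx_ratio I * potential (@start R I)].

Lemma wp_round st n : progress n st -> wp I round st (progress n.-1).
Proof.
case=> s [es out]; set c := foldl _ _ _ => stc misn costs.
have ci : injective c by apply: foldl_swap_inj; exact: bij_inj (start_bij I).
apply: wp_seq; apply: wp_weaken (wp_find_lightest stc) _.
move=> st1 [fr1 out1] found.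
have stc1 : stores st1 c by move=> t; rewrite fr1.
apply: wp_if; rewrite /= -ltnNge.
  case: found => [[x xE1 lx] _|[->]]; last by rewrite ltnn.
  have [d _ dK] := injF_bij (bij_inj (dest_bij I)); pose b := d (c x).
  have bx : dest b = c x by exact: dK.
  have xb : x != b.
    by case/andP: lx => + _; apply: contraNneq => xb; rewrite {2}xb bx.
  apply: wp_seq; apply: wp_weaken (wp_find_partner stc1 xE1 bx) _.
  move=> st2 [fr2 out2] bE2.
  have stc2 : stores st2 c by move=> t; rewrite fr2.
  have xE2 : nmem st2 a_light 0%N = val x by rewrite fr2.
  apply: wp_seq; apply: wp_weaken (wp_compute_dist stc2 xE2) _.
  move=> st3 [fr3 out3] dE3.
  have stc3 : stores st3 c by move=> t; rewrite fr3.
  have bE3 : nmem st3 a_partner 0%N = val b by rewrite fr3.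
  apply: wp_seq; apply: wp_weaken (wp_trace_path stc3 bE3 dE3) _.
  move=> st4 [fr4 out4] [P [P0 PE Padj]].
  have dist_n : (dist (c b) (c x) <= nv I)%N by rewrite ltnW // dist_lt_nv.
  have dE4 : neval I st4 path_length = dist (c b) (c x).
    by rewrite /= !fr4 // bE3 stc3 dE3.
  apply: wp_seq; apply: wp_weaken (wp_emit_forth (P := P) dE4 dist_n _) _.
    by move=> j /PE[].
  move=> st5 [fr5 _] out5.
  have dE5 : neval I st5 path_length = dist (c b) (c x).
    by rewrite -dE4 /= !fr5.
  apply: wp_seq; apply: wp_weaken (wp_emit_back (P := P) dE5 dist_n _) _.
    by move=> j /PE[<- _]; rewrite fr5.
  move=> st6 [fr6 _] out6.
  have stc6 : stores st6 c by move=> t; rewrite fr6 // fr5 // fr4 // stc3.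
  have xE6 : nmem st6 a_light 0%N = val x.
    by rewrite fr6 // fr5 // fr4 // fr3.
  have bE6 : nmem st6 a_partner 0%N = val b by rewrite fr6 // fr5 // fr4.
  apply: wp_weaken (wp_exchange_positions ci stc6 xE6 bE6 xb) _.
  move=> st7 [_ out7] stc7.
  have Pdist j : (j <= dist (c b) (c x))%N ->
    dist (P j) (c x) = (dist (c b) (c x) - j)%N by move=> /PE[].
  exists (s ++ exchange P 0 (dist (c b) (c x))); rewrite foldl_cat -/c; split.
  - by rewrite all_cat es all_adj_exchange.
  - rewrite out7 // out6 out5 out4 // out3 // out2 // out1 // out.
    by rewrite /encode /exchange !map_cat catA.
  - by move=> t; rewrite stc7 foldl_exchange.
  - have := card_misplaced_exchange ci lx bx P0 Pdist.
    by move: misn; lia.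
  - rewrite /cost cost_from_cat -/c -addrA -/(cost s).
    apply: le_trans (lerD (lexx _) _) costs.
    exact: exchange_amortized.
move=> no_light; apply: wp_skip; exists s; split=> //; first by rewrite out1.
case: found no_light => [[x -> _]|[_ none] _]; first by rewrite ltn_ord.
by rewrite (@eq_card0 _ [pred t | misplaced c t]) // => t; rewrite inE (negbTE (none t)).
Qed.

Lemma wp_token_swapping :
  wp I token_swapping (init_state R) (fun st' =>
    exists s : seq (vertex I * vertex I),
      [/\ output st' = encode s, solution s
        & cost s <= (2 + 2 * wmax I / wmin I) * OPT I]).
Proof.
apply: wp_seq.
apply: (wp_for (J := fun i st' =>
  forall t : token I, (t < i)%N -> nmem st' a_pos t = start t)) => //.
  move=> i st' iN + _.
  have -> : i = Ordinal iN by []. move: (Ordinal iN) => t tE Jt.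
  apply: wp_nset => u /=; rewrite tE readE ltnS leq_eqVlt /upd /= val_eqE.
  by case: eqVneq => [-> //|_ /= ut]; exact: Jt.
move=> st1 [_ out1] started.
apply: (wp_for (J := fun i => progress (nv I - i))) => //.
- exists [::]; split=> //; first by rewrite out1.
  + by move=> t; exact: started.
  + by rewrite subn0; apply: leq_trans (max_card _) _; rewrite card_ord.
  + by rewrite /cost /= add0r.
- by move=> i st' _ _ _ prog; rewrite subnS; exact: wp_round.
move=> st2 _ [s [es out _ misn costs]]; exists s; split=> //.
  rewrite /solution es; apply/forallP => t.
  move: misn; rewrite subnn leqn0 => /eqP/card0_eq/(_ t).
  by rewrite inE => /negbFE.
apply: le_trans (potential_start_le_OPT I); apply: le_trans costs.
by rewrite lerDl mulr_ge0 ?approx_ratio_ge0 ?potential_ge0.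
Qed.

End Correctness.

Theorem theorem3 (R : realType) :
  exists p : cmd,
    runs_in_polynomial_time R p /\
    forall I : instance R,
      exists (k : nat) (s : seq (vertex I * vertex I)),
        [/\ computes p k s,
            solution s
          & cost s <= (2 + 2 * wmax I / wmin I) * OPT I].
Proof.
exists token_swapping; split.
  have [c [d poly]] := time_bound_poly token_swapping; exists c, d => I.
  have [k [st [e kT [s [out _ _]]]]] := wp_token_swapping I.
  exists k, s; split; first by exists st.
  by apply: leq_trans kT _; apply: poly; exact: nv_gt0.
move=> I; have [k [st [e _ [s [out sol costs]]]]] := wp_token_swapping I.
by exists k, s; split=> //; exists st.
Qed.
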